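(* Let $1\le k\le n$, let $X_1,\ldots,X_n,Z$ be random variables with an arbitrary joint discrete distribution, taking only non-negative integers as values, and let $T=\min(X_{n-k+1:n}+Z,\,X_{n-k+2:n})$. For $u\le t$ put $$h_{k,n}(t,u)=P(X_{n-k+1:n}=u,\ X_{n-k+2:n}>t,\ Z>t-u).$$ Then for all $s,t=0,1,\ldots$ with $P(X_{n-k+1:n}>t)>0$, $$P(T-t>s\mid X_{n-k+1:n}>t)=\frac{\sum_{u=t+1}^{t+s}h_{k,n}(t+s,u)+P(X_{n-k+1:n}>s+t)}{P(X_{n-k+1:n}>t)}$$ $$=\frac{\sum_{u=t+1}^{t+s}h_{k,n}(t+s,u)}{P(X_{n-k+1:n}>t)}+P(X_{n-k+1:n}-t>s\mid X_{n-k+1:n}>t),$$ and $$E(T-t\mid X_{n-k+1:n}>t)=\frac1{P(X_{n-k+1:n}>t)}\sum_{s=t}^{\infty}\Big(\sum_{u=t+1}^{s}h_{k,n}(s,u)+P(X_{n-k+1:n}>s)\Big).$$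
   Context: $X_{1:n}\le\cdots\le X_{n:n}$ are the order statistics of $X_1,\ldots,X_n$ and $X_{n+1:n}:=\infty$ (so $T=X_{n:n}+Z$ for $k=1$). $T$ is the lifetime of a $k$-out-of-$n$ system with active component lifetimes $X_1,\ldots,X_n$ and one cold standby unit with lifetime $Z$. Empty sums are $0$; expectations are taken in $[0,\infty]$. *)

(* Defs.v *)
From HB Require Import structures.
From mathcomp Require Import all_boot all_order all_algebra.
From mathcomp Require Import all_classical all_reals all_analysis.
Set Implicit Arguments.
Unset Strict Implicit.
Unset Printing Implicit Defensive.
Import Order.TTheory GRing.Theory Num.Theory.
Local Open Scope classical_set_scope.
Local Open Scope ring_scope.
Local Open Scope ereal_scope.

(* Ranks are 1-based, so the intended range of j is 1 <= j; ranks above n give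
   +oo, which covers the convention X_{n+1:n} = oo. *)
Definition order_stat (R : realType) (n : nat) (x : 'I_n -> nat) (j : nat) :
    \bar R :=
  if (j <= n)%N then (nth 0%N (sort leq (codom x)) j.-1)%:R%:E else +oo.

(* X_{j:n} as a function on the sample space. *)
Definition rv_order_stat (R : realType) (Omega : Type) (n : nat)
    (X : 'I_n -> Omega -> nat) (j : nat) (w : Omega) : \bar R :=
  order_stat R (fun i => X i w) j.

Definition system_lifetime (R : realType) (Omega : Type) (n k : nat)
    (X : 'I_n -> Omega -> nat) (Z : Omega -> nat) (w : Omega) : \bar R :=
  mine (rv_order_stat R X (n - k + 1) w + (Z w)%:R%:E)
       (rv_order_stat R X (n - k + 2) w).

Section Conditioning.
Context d (Omega : measurableType d) (R : realType) (P : probability Omega R).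

Definition cond_prob (B A : set Omega) : \bar R := P (B `&` A) / P A.

(* Elementary conditional expectation given an event: E(Y 1_A) / P(A). *)
Definition cond_expectation (Y : Omega -> \bar R) (A : set Omega) : \bar R :=
  (\int[P]_(w in A) Y w) / P A.

(* Only used for u <= t, so that t - u is not truncated. *)
Definition h (n k : nat) (X : 'I_n -> Omega -> nat) (Z : Omega -> nat)
    (t u : nat) : \bar R :=
  P [set w | [/\ rv_order_stat R X (n - k + 1) w = u%:R%:E,
                 t%:R%:E < rv_order_stat R X (n - k + 2) w &
                 (t - u < Z w)%N]].

End Conditioning.

(* Main.v *)
(* Write Y for the (n-k+1)-th and V >= Y for the (n-k+2)-th order statistic, and
   split according to the value u of Y. If u > m then T > m is automatic, and if
   u <= m then T > m means that V > m and Z > m - u. For t <= m this expresses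
   P(T > m, Y > t) as the sum of the h(m, u) over t < u <= m plus P(Y > m).
   Taking m = t + s gives the conditional survival function; summing over
   m >= t gives the expectation, because T >= t wherever Y > t. *)
Require Import Defs.
From HB Require Import structures.
From mathcomp Require Import all_boot all_order all_algebra.
From mathcomp Require Import all_classical all_reals all_analysis.
From mathcomp Require Import measurable_realfun zify.
Import Order.TTheory GRing.Theory Num.Theory.
Local Open Scope classical_set_scope.
Local Open Scope ring_scope.
Local Open Scope ereal_scope.

(** A subset of a countable type is a countable union of points, so its preimage is a countable
    union of measurable fibres. *)
Lemma measurable_countable_preimage {d : measure_display}
    {Omega : measurableType d} {I : countType} {g : Omega -> I} (S : set I) :
  (forall i, measurable (g @^-1` [set i])) -> measurable (g @^-1` S).
Proof.
move=> mg.
have -> : g @^-1` S =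
    \bigcup_i (if `[< S i >] then g @^-1` [set i] else set0).
  apply/seteqP; split => [w Sw|w [i _]]; first by exists (g w); rewrite ?asboolT.
  by case: asboolP => // Si /= ->.
apply: countable_bigcupT_measurable; first exact: countableP.
by move=> i; case: ifP.
Qed.

(** The vector of all [X i] and [Z] takes countably many values, so every predicate of it is an
    event, however irregular. This settles measurability for order statistics and for the system
    lifetime at once. *)
Lemma measurable_rv_event {R : realType} {d : measure_display}
    {Omega : measurableType d} {P : probability Omega R} {n : nat}
    (X : 'I_n -> {RV P >-> nat}) (Z : {RV P >-> nat})
    (Q : ('I_n -> nat) -> nat -> Prop) :
  measurable [set w | Q (fun i => X i w) (Z w)].
Proof.
pose g (w : Omega) : {ffun 'I_n -> nat} * nat := ([ffun i => X i w], Z w).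
have -> : [set w | Q (fun i => X i w) (Z w)] =
    g @^-1` [set p : {ffun 'I_n -> nat} * nat | Q (fun i => p.1 i) p.2].
  apply/funext => w; rewrite /g /preimage /=; congr (Q _ _).
  by apply/funext => i; rewrite ffunE.
apply: measurable_countable_preimage => -[x z].
have mpre (f : {RV P >-> nat}) m : measurable (f @^-1` [set m]).
  by rewrite -[X in measurable X]setTI; exact: measurable_funP.
have -> : g @^-1` [set (x, z)] =
    (\bigcap_(i in [set: 'I_n]) (X i @^-1` [set x i])) `&` Z @^-1` [set z].
  apply/seteqP; split => [w [<- <-]|w [Xx /= <-]].
    by split => // i _ /=; rewrite ffunE.
  rewrite /g /preimage /=; congr (_, _); apply/ffunP => i.
  by rewrite ffunE; exact: (Xx i).
apply: measurableI => //; apply: fin_bigcap_measurable => //; exact: finite_finset.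
Qed.

Lemma le_order_stat {R : realType} {n : nat} (x : 'I_n -> nat) {i j : nat} :
  (i <= j)%N -> order_stat R x i <= order_stat R x j.
Proof.
move=> ij; rewrite /order_stat.
case: (leqP j n) => jn; last by rewrite leey.
rewrite (leq_trans ij jn) lee_fin ler_nat.
have sz : size (sort leq (codom x)) = n by rewrite size_sort size_codom card_ord.
(* Rank 0 forces [i = j]; for positive [j] the index [j.-1] is below [n], so no default of [nth] is
   read. *)
have [j0|j0] := posnP j; first by move: ij; rewrite j0 leqn0 => /eqP ->.
apply: (sorted_leq_nth leq_trans leqnn) => //; rewrite ?inE ?sz; try lia.
by apply: sort_sorted; exact: leq_total.
Qed.

Lemma order_stat_fin {R : realType} {n : nat} (x : 'I_n -> nat) {j : nat} :
  (j <= n)%N -> exists m : nat, order_stat R x j = m%:R%:E.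
Proof. by rewrite /order_stat => ->; eexists. Qed.

(** Finite additivity over the disjoint fibres of [y], by induction on the upper bound. *)
Lemma measure_fiber_sum {R : realType} {d : measure_display}
    {Omega : measurableType d} (mu : {measure set Omega -> \bar R})
    {y : Omega -> nat} {B : set Omega} (a b : nat) :
  measurable B -> (forall u, measurable (y @^-1` [set u])) ->
  \sum_(a <= u < b) mu (B `&` y @^-1` [set u]) =
  mu (B `&` [set w | (a <= y w < b)%N]).
Proof.
move=> mB my.
have mS (S : set nat) : measurable (y @^-1` S).
  exact: measurable_countable_preimage.
(* An empty range makes both sides 0; this covers the base case and every step with [b < a]. *)
have empty c : (c <= a)%N -> \sum_(a <= u < c) mu (B `&` y @^-1` [set u]) =
    mu (B `&` [set w | (a <= y w < c)%N]).
  move=> ca; rewrite big_geq// (_ : _ `&` _ = set0) ?measure0//.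
  by rewrite -subset0 => w [_ /= ]; lia.
elim: b => [|b IH]; first exact: empty.
have [ab|ba] := leqP a b; last exact: empty.
rewrite big_nat_recr//= IH -measureU//.
- congr (mu _); apply/seteqP; split => w /=.
    by move=> [[? ?]|[? ?]]; split => //; lia.
  move=> [? ?]; have [->|?] := eqVneq (y w) b; first by right.
  by left; split => //; lia.
- by apply: measurableI => //; exact: (mS [set m | (a <= m < b)%N]).
- exact: measurableI.
- by rewrite -subset0 => w [[_ /= +] [_ /= yb]]; rewrite yb; lia.
Qed.

Lemma nneseries_indic_nat (R : realType) (N t : nat) : (t <= N)%N ->
  \sum_(t <= s <oo) ((s < N)%N%:R%:E : \bar R) = N%:R%:E - t%:R%:E.
Proof.
move=> tN; rewrite (@nneseries_split _ _ t (N - t)); last first.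
  by move=> s _; rewrite lee_fin.
rewrite subnKC// eseries0; last by move=> s Ns _; rewrite ltnNge Ns.
rewrite adde0 (eq_big_nat _ _ (F2 := fun=> 1%:E)); last first.
  by move=> s /andP[_ ->].
by rewrite sumEFin sumr_const_nat -EFinB natrB.
Qed.

(** Tail-sum formula: pointwise, [tau - t] counts the integers [s] with [t <= s < tau], hence is a
    series of indicators, and nonnegativity lets sum and integral be exchanged. *)
Lemma integral_nat_tail (R : realType) (d : measure_display)
    (Omega : measurableType d) (mu : {measure set Omega -> \bar R})
    (tau : Omega -> nat) (A : set Omega) (t : nat) :
  measurable A -> (forall s, measurable [set w | (s < tau w)%N]) ->
  (forall w, A w -> (t <= tau w)%N) ->
  \int[mu]_(w in A) ((tau w)%:R%:E - t%:R%:E) =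
  \sum_(t <= s <oo) mu ([set w | (s < tau w)%N] `&` A).
Proof.
move=> mA mtau At.
(* The series is shifted to start at 0 for the exchange and shifted back afterwards. *)
transitivity (\int[mu]_(w in A)
    \sum_(0 <= s <oo) (\1_[set w | (s + t < tau w)%N] w)%:E).
  apply: eq_integral => w /[!inE] Aw.
  rewrite -nneseries_indic_nat ?At// -nneseries_addn; last first.
    by move=> s; rewrite lee_fin.
  apply: eq_eseriesr => s _; rewrite indicE; congr (_%:R%:E).
  by congr nat_of_bool; apply/idP/idP; rewrite in_setE.
rewrite integral_nneseries//; last first.
  move=> s; apply/measurable_EFinP; exact: measurable_indic.
rewrite -[RHS]nneseries_addn//; apply: eq_eseriesr => s _.
by rewrite integral_indic.
Qed.

Section Survival.
Context {R : realType} {d : measure_display} {Omega : measurableType d}.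
Context {P : probability Omega R} {n k : nat}.
Hypotheses (hk1 : (1 <= k)%N) (hkn : (k <= n)%N).
Context (X : 'I_n -> {RV P >-> nat}) (Z : {RV P >-> nat}).

Let Y := rv_order_stat R X (n - k + 1).
Let V := rv_order_stat R X (n - k + 2).
Let T := system_lifetime R k X Z.

(** Since [1 <= k <= n], the rank [n - k + 1] is at most [n], so the value [+oo] does not occur. *)
Lemma rv_order_stat_nat : exists y : Omega -> nat, forall w, Y w = (y w)%:R%:E.
Proof.
have fin w : exists m : nat, Y w = m%:R%:E by apply: order_stat_fin; lia.
by have [y yE] := choice fin; exists y.
Qed.

Lemma system_lifetime_nat :
  exists tau : Omega -> nat, forall w, T w = (tau w)%:R%:E.
Proof.
have [y yE] := rv_order_stat_nat.
suff fin w : exists m : nat, T w = m%:R%:E.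
  by have [tau tauE] := choice fin; exists tau.
rewrite /T /system_lifetime -/(Y w) yE -EFinD -natrD /rv_order_stat.
have [kn|kn] := leqP (n - k + 2) n.
  have [v ->] := order_stat_fin (R := R) (fun i => X i w) kn.
  by rewrite /mine; case: ifP => _; eexists.
(* Here [k = 1]: the second argument of the minimum is [+oo], and the lifetime is [Y + Z]. *)
by rewrite /order_stat leqNgt kn/= /mine ltry; eexists.
Qed.

Lemma measurable_rv_order_stat_gt (t : nat) : measurable [set w | t%:R%:E < Y w].
Proof.
exact: (measurable_rv_event X Z
  (fun x _ => t%:R%:E < order_stat R x (n - k + 1) : Prop)).
Qed.

Lemma measurable_system_lifetime_gt (t : nat) : measurable [set w | t%:R%:E < T w].
Proof.
exact: (measurable_rv_event X Z
  (fun x z => t%:R%:E < mine (order_stat R x (n - k + 1) + z%:R%:E)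
                             (order_stat R x (n - k + 2)) : Prop)).
Qed.

Lemma lifetime_survival {t m : nat} : (t <= m)%N ->
  P ([set w | m%:R%:E < T w] `&` [set w | t%:R%:E < Y w]) =
  \sum_(t.+1 <= u < m.+1) h P k X Z m u + P [set w | m%:R%:E < Y w].
Proof.
move=> tm; have [y yE] := rv_order_stat_nat.
have my u : measurable (y @^-1` [set u]).
  rewrite (_ : _ @^-1` _ = [set w | Y w = u%:R%:E]); last first.
    apply/seteqP; split => w /=; rewrite yE; first by move=> ->.
    by move=> [/eqP]; rewrite eqr_nat => /eqP.
  exact: (measurable_rv_event X Z
    (fun x _ => order_stat R x (n - k + 1) = u%:R%:E)).
have mB := measurable_system_lifetime_gt m.
have Tgt w : (m%:R%:E < T w) =
    (m < y w + Z w)%N && (m%:R%:E < V w).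
  by rewrite /T /system_lifetime lt_min -/(Y w) yE -EFinD -natrD lte_fin ltr_nat.
have YV w : (y w)%:R%:E <= V w.
  by rewrite -yE; apply: le_order_stat; lia.
(* Disjoint split at [y w <= m]; the second piece lies in the event because [m < Y] gives
   [m < Y + Z] and [m < V], and [t <= m] gives [t < Y]. *)
transitivity (P (([set w | m%:R%:E < T w] `&` [set w | (t < y w < m.+1)%N])
    `|` [set w | m%:R%:E < Y w])).
  congr (P _); apply/seteqP; split => w /=; rewrite !yE !lte_fin !ltr_nat.
    by move=> [mT ty]; have [ym|ym] := leqP (y w) m; [left; split => //; lia|right].
  move=> [[mT ?]|my']; split => //; try lia.
  rewrite Tgt; apply/andP; split; first lia.
  by rewrite (lt_le_trans _ (YV w))// lte_fin ltr_nat.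
rewrite measureU; last 3 first.
- apply: measurableI => //.
  exact: (measurable_countable_preimage [set u | (t < u < m.+1)%N]).
- exact: measurable_rv_order_stat_gt.
- rewrite -subset0 => w [[_ /= +]]; rewrite yE lte_fin ltr_nat; lia.
congr (_ + _); apply: etrans (esym (measure_fiber_sum P t.+1 m.+1 mB my)) _.
(* On the fibre [y w = u] with [u <= m], the subtraction is not truncated, so [m < u + Z] is the
   same as [m - u < Z]. *)
apply: eq_big_nat => u um; rewrite /h; congr (P _).
rewrite -/Y -/V; apply/seteqP; split => w /=; rewrite Tgt -/(Y w) -/(V w) yE.
  by move=> [/andP[mz mV] yu]; split => //; [rewrite yu|lia].
move=> [[/eqP]]; rewrite eqr_nat => /eqP yu mV mz; split => //.
by rewrite mV andbT; lia.
Qed.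

End Survival.

Theorem theorem3p4 (R : realType) (d : measure_display)
    (Omega : measurableType d) (P : probability Omega R)
    (n k : nat) (hk1 : (1 <= k)%N) (hkn : (k <= n)%N)
    (X : 'I_n -> {RV P >-> nat}) (Z : {RV P >-> nat}) :
  let Y := rv_order_stat R X (n - k + 1) in
  let T := system_lifetime R k X Z in
  let A (t : nat) := [set w | t%:R%:E < Y w] in
  forall t : nat, 0 < P (A t) ->
    (forall s : nat,
       cond_prob P [set w | s%:R%:E < T w - t%:R%:E] (A t) =
         (\sum_(t.+1 <= u < (t + s).+1) h P k X Z (t + s) u
            + P (A (s + t)%N)) / P (A t)
       /\
       (\sum_(t.+1 <= u < (t + s).+1) h P k X Z (t + s) u
          + P (A (s + t)%N)) / P (A t) =
         (\sum_(t.+1 <= u < (t + s).+1) h P k X Z (t + s) u) / P (A t)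
           + cond_prob P [set w | s%:R%:E < Y w - t%:R%:E] (A t))
    /\
    cond_expectation P (fun w => T w - t%:R%:E) (A t) =
      (P (A t))^-1 *
      \sum_(t <= s <oo)
        (\sum_(t.+1 <= u < s.+1) h P k X Z s u + P (A s)).
Proof.
move=> Y T A t At0.
have mA s : measurable (A s) by exact: measurable_rv_order_stat_gt.
(* Shifting by the finite constant [t] is harmless even for infinite values; this serves both [T]
   and [Y]. *)
have cond_lt s (U : Omega -> \bar R) :
    [set w | s%:R%:E < U w - t%:R%:E] = [set w | (t + s)%:R%:E < U w].
  by apply: eq_set => w; rewrite lteBrDr// -EFinD -natrD addnC.
split=> [s|].
  have sumE := lifetime_survival hk1 hkn X Z (leq_addr s t).
  split.
    by rewrite /cond_prob cond_lt sumE (addnC s).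
  rewrite ge0_muleDl ?sume_ge0//; congr (_ + _).
  rewrite /cond_prob cond_lt (addnC s); congr (P _ / _).
  (* The event [Y > t + s] already lies inside the conditioning event [Y > t]. *)
  apply/esym/setIidPl => w /=; apply: le_lt_trans.
  by rewrite lee_fin ler_nat leq_addr.
have [tau tauE] : exists tau : Omega -> nat, forall w, T w = (tau w)%:R%:E.
  exact: system_lifetime_nat.
rewrite /cond_expectation muleC; congr (_ * _).
have tau_gt s : [set w | (s < tau w)%N] = [set w | s%:R%:E < T w].
  by apply: eq_set => w; rewrite tauE lte_fin ltr_nat.
have -> : (fun w => T w - t%:R%:E) = (fun w => (tau w)%:R%:E - t%:R%:E).
  by apply/funext => w; rewrite -tauE.
rewrite integral_nat_tail//; last 2 first.
- by move=> s; rewrite tau_gt; exact: measurable_system_lifetime_gt.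
(* Both arguments of the minimum are at least [Y], which exceeds [t] on [A t]. *)
- move=> w Aw; rewrite -(ler_nat R) -lee_fin -tauE.
  rewrite /system_lifetime le_min; apply/andP; split.
    by rewrite (le_trans (ltW Aw))// leeDl// lee_fin.
  by rewrite (le_trans (ltW Aw))//; apply: le_order_stat; lia.
(* The lower bound becomes a condition on the index, which supplies the [t <= s] that the survival
   identity requires. *)
rewrite eseries_cond [RHS]eseries_cond; apply: eq_eseriesr => s /andP[_ ts].
by rewrite tau_gt; exact: lifetime_survival.
Qed.
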